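(* Let $A\in M_n(\mathbb{C})$. Then the following are equivalent: (i) $A$ is a P-matrix. (ii) There exists $\alpha\subseteq\langle n\rangle$ such that $\mathrm{ppt}(A,\alpha)$ is (defined and is) a P-matrix. (iii) For all $\alpha\subseteq\langle n\rangle$, $\mathrm{ppt}(A,\alpha)$ is (defined and is) a P-matrix.
   Context: $M_n(\mathbb{C})$ is the set of $n\times n$ complex matrices and $\langle n\rangle=\{1,\ldots,n\}$. For $\alpha\subseteq\langle n\rangle$ let $\alpha^c=\langle n\rangle\setminus\alpha$. $A[\alpha,\beta]$ is the submatrix of $A$ with rows indexed by $\alpha$ and columns indexed by $\beta$ (indices in ascending order); $A[\alpha]=A[\alpha,\alpha]$, $A(\alpha,\alpha]=A[\alpha^c,\alpha]$, $A[\alpha,\alpha)=A[\alpha,\alpha^c]$, $A(\alpha)=A[\alpha^c,\alpha^c]$. An empty submatrix has determinant $1$ by convention. If $A[\alpha]$ is invertible, the Schur complement is $A/A[\alpha]=A(\alpha)-A(\alpha,\alpha]A[\alpha]^{-1}A[\alpha,\alpha)$, and the principal pivot transform $\mathrm{ppt}(A,\alpha)$ of $A$ relative to $\alpha$ is the $n\times n$ matrix obtained from $A$ by replacing, in place, $A[\alpha]$ by $A[\alpha]^{-1}$, $A[\alpha,\alpha)$ by $-A[\alpha]^{-1}A[\alpha,\alpha)$, $A(\alpha,\alpha]$ by $A(\alpha,\alpha]A[\alpha]^{-1}$, and $A(\alpha)$ by $A/A[\alpha]$; by convention $\mathrm{ppt}(A,\emptyset)=A$. Thus $\mathrm{ppt}(A,\alpha)$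 is defined exactly when $A[\alpha]$ is invertible (the case $\alpha=\emptyset$ being always allowed). A matrix in $M_n(\mathbb{C})$ is a P-matrix if all of its principal minors are positive (real) numbers. *)

(* Defs.v *)
From HB Require Import structures.
From mathcomp Require Import all_boot all_order all_algebra.
From mathcomp Require Import reals complex.

Set Implicit Arguments.
Unset Strict Implicit.
Unset Printing Implicit Defensive.

Import Order.TTheory GRing.Theory Num.Theory.
Local Open Scope ring_scope.

(* A[a, b].  [enum_val] lists the elements of a set of ordinals in increasing
   order, so rows and columns of the submatrix are in ascending order. *)
Definition submx_set (F : Type) (n : nat) (a b : {set 'I_n}) (A : 'M[F]_n) :
    'M[F]_(#|a|, #|b|) :=
  mxsub (fun k => enum_val k) (fun l => enum_val l) A.

(* The n x n matrix carrying the block B at the positions a x b, in place,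
   and zero elsewhere: each of the two sums has at most one term. *)
Definition place_mx (F : nmodType) (n : nat) (a b : {set 'I_n})
    (B : 'M[F]_(#|a|, #|b|)) : 'M[F]_n :=
  \matrix_(i, j) \sum_(k < #|a| | enum_val k == i)
                   \sum_(l < #|b| | enum_val l == j) B k l.

Section PrincipalPivot.
Variables (F : fieldType) (n : nat).
Implicit Types (A : 'M[F]_n) (a : {set 'I_n}).

Definition schur_compl A a : 'M[F]_#|~: a| :=
  submx_set (~: a) (~: a) A
  - submx_set (~: a) a A *m invmx (submx_set a a A) *m submx_set a (~: a) A.

(* The matrix of determinant 1 of size 0 is a unit, so this holds for
   a = set0 (see [ppt_defined0]). *)
Definition ppt_defined A a : bool := submx_set a a A \in unitmx.

(* Meaningful only when [ppt_defined A a]: [invmx] is total. *)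
Definition ppt A a : 'M[F]_n :=
  place_mx (invmx (submx_set a a A))
  + place_mx (- (invmx (submx_set a a A) *m submx_set a (~: a) A))
  + place_mx (submx_set (~: a) a A *m invmx (submx_set a a A))
  + place_mx (schur_compl A a).

End PrincipalPivot.

(* For a complex number z, [0 < z] means that z is real and positive. *)
Definition P_matrix (F : numDomainType) (n : nat) (A : 'M[F]_n) : Prop :=
  forall a : {set 'I_n}, 0 < \det (submx_set a a A).

Section Sanity.
Variables (F : fieldType) (n : nat).
Implicit Types (A : 'M[F]_n) (a b c d : {set 'I_n}).

Lemma place_mxK a b (B : 'M[F]_(#|a|, #|b|)) : submx_set a b (place_mx B) = B.
Proof.
apply/matrixP=> k l; rewrite !mxE (big_pred1 k) => [|k'].
  by rewrite (big_pred1 l) // => l'; rewrite (inj_eq enum_val_inj).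
by rewrite (inj_eq enum_val_inj).
Qed.

Lemma place_mx_disjl a b c d (B : 'M[F]_(#|a|, #|b|)) :
  [disjoint a & c] -> submx_set c d (place_mx B) = 0.
Proof.
move=> dac; apply/matrixP=> k l; rewrite !mxE big_pred0 // => k'.
apply/eqP=> e; move: (enum_valP k); rewrite -e => kc.
by rewrite (disjointFr dac (enum_valP k')) in kc.
Qed.

Lemma place_mx_disjr a b c d (B : 'M[F]_(#|a|, #|b|)) :
  [disjoint b & d] -> submx_set c d (place_mx B) = 0.
Proof.
move=> dbd; apply/matrixP=> k l; rewrite !mxE big1 // => k' _.
rewrite big_pred0 // => l'; apply/eqP=> e.
move: (enum_valP l); rewrite -e => ld.
by rewrite (disjointFr dbd (enum_valP l')) in ld.
Qed.

Lemma submx_setD a b A A' :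
  submx_set a b (A + A') = submx_set a b A + submx_set a b A'.
Proof. by apply/matrixP=> i j; rewrite !mxE. Qed.

Lemma disj_setC a : [disjoint a & ~: a].
Proof. by rewrite -setI_eq0 setICr. Qed.

Lemma disj_setCl a : [disjoint ~: a & a].
Proof. by rewrite disjoint_sym disj_setC. Qed.

Lemma ppt_ul A a : submx_set a a (ppt A a) = invmx (submx_set a a A).
Proof.
rewrite !submx_setD place_mxK (place_mx_disjr _ _ (disj_setCl a)).
by rewrite !(place_mx_disjl _ _ (disj_setCl a)) !addr0.
Qed.

Lemma ppt_ur A a :
  submx_set a (~: a) (ppt A a)
  = - (invmx (submx_set a a A) *m submx_set a (~: a) A).
Proof.
rewrite !submx_setD place_mxK (place_mx_disjr _ _ (disj_setC a)).
by rewrite !(place_mx_disjl _ _ (disj_setCl a)) !addr0 add0r.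
Qed.

Lemma ppt_dl A a :
  submx_set (~: a) a (ppt A a)
  = submx_set (~: a) a A *m invmx (submx_set a a A).
Proof.
rewrite !submx_setD place_mxK !(place_mx_disjl _ _ (disj_setC a)).
by rewrite (place_mx_disjr _ _ (disj_setCl a)) addr0 !add0r.
Qed.

Lemma ppt_dr A a : submx_set (~: a) (~: a) (ppt A a) = schur_compl A a.
Proof.
rewrite !submx_setD place_mxK !(place_mx_disjl _ _ (disj_setC a)).
by rewrite (place_mx_disjr _ _ (disj_setC a)) !add0r.
Qed.

Lemma ppt_defined0 A : ppt_defined A set0.
Proof.
rewrite /ppt_defined; move: (submx_set _ _ _); rewrite cards0 => M.
by rewrite unitmxE det_mx00 unitr1.
Qed.

Lemma ppt0 A : ppt A set0 = A.
Proof.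
have inT i : i \in ~: (set0 : {set 'I_n}) by rewrite setC0 inE.
have e : submx_set (~: set0) (~: set0) (ppt A set0)
       = submx_set (~: set0) (~: set0) A.
  rewrite ppt_dr /schur_compl [X in _ - X](_ : _ = 0) ?subr0 //.
  apply/matrixP=> i j; rewrite !mxE big1 // => k _.
  by have := enum_valP k; rewrite inE.
apply/matrixP=> i j.
have := congr1 (fun M : 'M_(_, _) =>
  M (enum_rank_in (inT i) i) (enum_rank_in (inT i) j)) e.
by rewrite !mxE !enum_rankK_in.
Qed.

End Sanity.

(* Main.v *)
Require Import Defs.
From mathcomp Require Import all_boot all_order all_algebra.
From mathcomp Require Import perm reals complex.

(** The principal pivot transform exchanges part of the input with part of the
    output of a linear map: if [y = A x] and [B = ppt A a], then [B] sends the
    vector with entries [y] on [a] and [x] off [a] to the vector with entries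
    [x] on [a] and [y] off [a].

    Write [C_a] for the matrix whose rows in [a] are those of [A] and whose
    other rows are those of the identity ([id_outside a A] below).  The exchange
    property is the matrix identity [B C_a = C_(~: a)] ([mul_ppt_id_outside]).
    Now compare, row by row, [B] with the rows outside [b] made trivial, times
    [C_a]: rows in [b] are rows of [B C_a = C_(~: a)], the others are rows of
    [C_a].  Hence row [i] of the product is a row of [A] exactly when [i] lies
    in one of [a], [b] but not in both: the product is [C_d], with [d] the
    symmetric difference of [a] and [b].  Since [det C_a] is the principal minor
    [det A[a]] ([det_id_outside]), taking determinants gives
    [det B[b] * det A[a] = det A[d]] ([det_submx_ppt]).

    So, up to the factor [det A[a]], the principal minors of [B] are those of
    [A], permuted by the involution [b |-> d].  The factor is itself a minor of
    [A]; its inverse is a minor of [B], since [b = a] gives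
    [det B[a] * det A[a] = 1].  Hence it is positive as soon as [A] or [B] is a
    P-matrix, and then all minors of [A] are positive iff all those of [B]
    are. *)

Set Implicit Arguments.
Unset Strict Implicit.
Unset Printing Implicit Defensive.

Import Order.TTheory GRing.Theory Num.Theory.
Local Open Scope ring_scope.

Lemma det_mxsub_bij (R : comNzRingType) (m n : nat) (f : 'I_m -> 'I_n)
    (A : 'M[R]_n) :
  bijective f -> \det (mxsub f f A) = \det A.
Proof.
move=> bij_f; have eq_mn : m = n by have := bij_eq_card bij_f; rewrite !card_ord.
subst m; pose s := perm (bij_inj bij_f).
have -> : mxsub f f A = row_perm s (col_perm s A).
  by apply/matrixP=> i j; rewrite !mxE !permE.
rewrite row_permE col_permE !det_mulmx !det_perm odd_permV.
by rewrite mulrCA -signr_addb addbb mulr1.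
Qed.

(** Enumerates [a] before its complement, so that reindexing a matrix by it turns
    submatrices of index sets [a] and [~: a] into the blocks of a [block_mx]. *)
Definition ord_of_blocks n (a : {set 'I_n}) (k : 'I_(#|a| + #|~: a|)) : 'I_n :=
  match split k with inl i => enum_val i | inr j => enum_val j end.

Lemma ord_of_blocks_bij n (a : {set 'I_n}) : bijective (@ord_of_blocks n a).
Proof.
apply: inj_card_bij; last by rewrite !card_ord cardsC card_ord.
move=> k l; rewrite /ord_of_blocks -[k]splitK -[l]splitK !unsplitK.
case: (split k) (split l) => [i|i] [j|j] => /= eq_ij.
- by rewrite (enum_val_inj eq_ij).
- by have := enum_valP j; rewrite -eq_ij inE enum_valP.
- by have := enum_valP i; rewrite eq_ij inE enum_valP.
- by rewrite (enum_val_inj eq_ij).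
Qed.

Lemma mxsub_ord_of_blocks (T : Type) n (a : {set 'I_n}) (A : 'M[T]_n) :
  mxsub (@ord_of_blocks n a) (@ord_of_blocks n a) A =
  block_mx (submx_set a a A) (submx_set a (~: a) A)
           (submx_set (~: a) a A) (submx_set (~: a) (~: a) A).
Proof.
apply/matrixP=> k l; rewrite -[k]splitK -[l]splitK.
case: (split k) (split l) => [i|i] [j|j] /=;
  by rewrite (block_mxEul, block_mxEur, block_mxEdl, block_mxEdr) !mxE
             /ord_of_blocks ?(unsplitK (inl _)) ?(unsplitK (inr _)).
Qed.

Section PivotMinors.
Variables (F : fieldType) (n : nat).
Implicit Types (A : 'M[F]_n) (a b c : {set 'I_n}).

Definition id_outside a A : 'M[F]_n :=
  \matrix_(i, j) if i \in a then A i j else (i == j)%:R.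

Lemma submx_id_outside_in a b c A :
  b \subset a -> submx_set b c (id_outside a A) = submx_set b c A.
Proof.
by move=> /subsetP sba; apply/matrixP=> i j; rewrite !mxE sba ?enum_valP.
Qed.

Lemma submx_id_outside_diag a b A :
  [disjoint b & a] -> submx_set b b (id_outside a A) = 1%:M.
Proof.
move=> dba; apply/matrixP=> i j.
by rewrite !mxE (disjointFr dba) ?enum_valP // (inj_eq enum_val_inj).
Qed.

Lemma submx_id_outside_off a b c A :
  [disjoint b & a] -> [disjoint b & c] -> submx_set b c (id_outside a A) = 0.
Proof.
move=> dba dbc; apply/matrixP=> i j; rewrite !mxE (disjointFr dba) ?enum_valP //.
case: eqP => // eq_ij; have := disjointFr dbc (enum_valP i).
by rewrite eq_ij enum_valP.
Qed.

(** With [a] listed first, the matrix is block upper triangular with diagonal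
    blocks [A[a]] and the identity. *)
Lemma det_id_outside a A : \det (id_outside a A) = \det (submx_set a a A).
Proof.
rewrite -(det_mxsub_bij _ (ord_of_blocks_bij a)) mxsub_ord_of_blocks.
rewrite submx_id_outside_in // (submx_id_outside_off _ (disj_setCl a)) ?disj_setCl //.
by rewrite submx_id_outside_diag ?disj_setCl // det_ublock det1 mulr1.
Qed.

(** The exchange property of the pivot transform: with [x] arbitrary and
    [y = A x], [id_outside a A] sends [x] to the vector mixing [y] on [a] with
    [x] off [a], and [id_outside (~: a) A] sends it to the opposite mix. *)
Lemma mul_ppt_id_outside a A :
  ppt_defined A a -> ppt A a *m id_outside a A = id_outside (~: a) A.
Proof.
rewrite /ppt_defined => unitAa; set f := @ord_of_blocks n a.
have [g _ fK] := ord_of_blocks_bij a.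
have mxsub_inj : injective (mxsub f f : 'M[F]_n -> _).
  move=> X Y /matrixP eqXY; apply/matrixP=> i j.
  by have := eqXY (g i) (g j); rewrite !mxE /f !fK.
apply: mxsub_inj.
have -> : mxsub f f (ppt A a *m id_outside a A)
          = mxsub f f (ppt A a) *m mxsub f f (id_outside a A).
  apply/matrixP=> i j; rewrite !mxE.
  rewrite (reindex f) /=; last exact: onW_bij (ord_of_blocks_bij a).
  by apply: eq_bigr => k _; rewrite !mxE.
rewrite /f !mxsub_ord_of_blocks ppt_ul ppt_ur ppt_dl ppt_dr /schur_compl.
rewrite !(@submx_id_outside_in a a) // !(@submx_id_outside_in (~: a) (~: a)) //.
rewrite !(submx_id_outside_diag, submx_id_outside_off)
        ?disj_setC ?disj_setCl //.
rewrite mulmx_block !mulmx0 !mulmx1 !addr0 mulVmx // mulmxKV //.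
by rewrite subrr addrC subrK.
Qed.

(** Left multiplication acts row by row, so the exchange property decides the
    rows in [b], while off [b] the rows of [id_outside a A] are kept.  Both kinds
    are rows of [A] or of the identity, and the first case occurs at [i] when
    [i] is in exactly one of [a] and [b]. *)
Lemma mul_id_outside_ppt a b A :
  ppt_defined A a ->
  id_outside b (ppt A a) *m id_outside a A
  = id_outside ((a :\: b) :|: (b :\: a)) A.
Proof.
move=> defA; have /matrixP exchange := mul_ppt_id_outside defA.
apply/matrixP=> i j; move: (exchange i j); rewrite !mxE !inE.
case ib: (i \in b) => /=.
  rewrite andbT => <-; apply: eq_bigr => k _.
  by rewrite !mxE ib.
rewrite andbF orbF => _; rewrite (bigD1 i) //= big1 => [|k ki].
  by rewrite !mxE ib eqxx mul1r addr0.
by rewrite !mxE ib eq_sym (negPf ki) mul0r.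
Qed.

Lemma det_submx_ppt a b A :
  ppt_defined A a ->
  \det (submx_set b b (ppt A a)) * \det (submx_set a a A)
  = \det (submx_set ((a :\: b) :|: (b :\: a)) ((a :\: b) :|: (b :\: a)) A).
Proof. by move=> defA; rewrite -!det_id_outside -det_mulmx mul_id_outside_ppt. Qed.

End PivotMinors.

Lemma P_matrix_ppt (F : numFieldType) n (A : 'M[F]_n) (a : {set 'I_n}) :
  P_matrix A -> ppt_defined A a /\ P_matrix (ppt A a).
Proof.
move=> PA; have defA : ppt_defined A a.
  by rewrite /ppt_defined unitmxE unitfE gt_eqF ?PA.
by split=> // b; rewrite -(pmulr_lgt0 _ (PA a)) det_submx_ppt ?PA.
Qed.

Lemma ppt_P_matrix (F : numFieldType) n (A : 'M[F]_n) (a : {set 'I_n}) :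
  ppt_defined A a -> P_matrix (ppt A a) -> P_matrix A.
Proof.
move=> defA PB.
have detAa_gt0 : 0 < \det (submx_set a a A).
  rewrite -(pmulr_rgt0 _ (PB a)) det_submx_ppt // setDv setU0.
  by rewrite -det_id_outside (_ : id_outside _ _ = 1%:M) ?det1 ?ltr01 //;
     apply/matrixP=> i j; rewrite !mxE inE.
move=> c; set b := (a :\: c) :|: (c :\: a).
(* Symmetric difference with [a] is an involution, so [b] yields the minor
   of index set [c]. *)
have -> : c = (a :\: b) :|: (b :\: a).
  by apply/setP=> i; rewrite !inE; case: (i \in a); case: (i \in c).
by rewrite -det_submx_ppt // mulr_gt0.
Qed.

Theorem theorem5p3 (R : realType) (n : nat) (A : 'M[R[i]]_n) :
  (P_matrix A <->
     exists a : {set 'I_n}, ppt_defined A a /\ P_matrix (ppt A a)) /\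
  (P_matrix A <->
     forall a : {set 'I_n}, ppt_defined A a /\ P_matrix (ppt A a)).
Proof.
split; split.
- by move=> PA; exists set0; apply: P_matrix_ppt.
- by case=> a [defA PB]; apply: ppt_P_matrix defA PB.
- by move=> PA a; apply: P_matrix_ppt.
- by move=> /(_ set0) [defA PB]; apply: ppt_P_matrix defA PB.
Qed.
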